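(* Let $\mu$ and $\nu$ be two probability measures on $\Omega=\{-1,1\}^{\mathbb{Z}^d}$. Let $\mathcal L_{\mathcal B}$ be the generator of a translation-invariant finite-range spin-flip dynamics and let $S(t)$ denote the corresponding semigroup. If $\mu\neq\nu$ then $\mu S(t)\ne\nu S(t)$ for all $t>0$.
   Context: $\Omega=\{-1,1\}^{\mathbb{Z}^d}$ has the product topology; $\mathscr C(\Omega)$ is the space of real continuous functions with the supremum norm; a function is local if it depends on finitely many coordinates. $\sigma^i$ is $\sigma$ with the spin at $i$ flipped, $\nabla_i f(\sigma)=f(\sigma^i)-f(\sigma)$, and $\sigma_B=\prod_{i\in B}\sigma_i$ for finite $B\subset\mathbb{Z}^d$ ($\sigma_\emptyset=1$). For finite $B\subset\mathbb{Z}^d$, $L_B=\sum_{i\in\mathbb{Z}^d}\sigma_{B+i}\nabla_i$ on local functions. A translation-invariant finite-range spin-flip generator is $\mathcal L_{\mathcal B}=\sum_{B\in\mathcal B}\lambda(B)L_B$, where $\mathcal B$ is a finite collection of finite subsets of $\mathbb{Z}^d$ and $\lambda:\mathcal B\to\mathbb{R}$; i.e. the flip rates are $c(i,\sigma)=\sum_{B\in\mathcal B}\lambda(B)\sigma_{B+i}$, assumed strictly positive: $\inf_{i,\sigma}c(i,\sigma)>0$. The closure of $\mathcal L_{\mathcal B}$ in $\mathscr C(\Omega)$ generates a Feller process with semigroup $S(t)$; $\mu S(t)$ is determined by $\int f\,d\mu S(t)=\int S(t)f\,d\mu$ for $f\in\mathscr C(\Omega)$. *)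

(* Defs.v *)
From HB Require Import structures.
From mathcomp Require Import all_boot all_order all_algebra finmap.
From mathcomp Require Import all_classical all_reals all_analysis.
Import Order.TTheory GRing.Theory Num.Theory numFieldNormedType.Exports.

Set Implicit Arguments.
Unset Strict Implicit.
Unset Printing Implicit Defensive.

Local Open Scope classical_set_scope.
Local Open Scope ring_scope.

Notation lattice d := 'rV[int]_d.

(* A configuration stores each spin of {-1, 1} as a boolean, [true] for +1 and
   [false] for -1 (see [spin]); [bool] carries the discrete topology. *)
Definition Omega (d : nat) : Type := prod_topology (fun _ : lattice d => bool).

HB.instance Definition _ (d : nat) := Topological.copy (Omega d)
  (prod_topology (fun _ : lattice d => bool)).
HB.instance Definition _ (d : nat) :=
  isPointed.Build (Omega d) (fun _ : lattice d => true).

Definition borelOmega (d : nat) := g_sigma_algebraType (@open (Omega d)).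

Section SpinFlip.
Context {R : realType} {d : nat}.
Implicit Types (f g : Omega d -> R) (s : Omega d) (i : lattice d).
Implicit Types (B : {fset lattice d}) (BB : {fset {fset lattice d}}).
Implicit Types (lam : {fset lattice d} -> R).

Definition spin s i : R := if s i then 1 else -1.

Definition flip s i : Omega d := fun j => if j == i then ~~ s j else s j.

Definition nabla i f : Omega d -> R := fun s => f (flip s i) - f s.

(* The product of the spins over the translate [B + i]. *)
Definition spin_prod B i s : R := \prod_(j <- B) spin s (j + i).

Definition local f : Prop := exists A : {fset lattice d},
  forall s1 s2, (forall j, j \in A -> s1 j = s2 j) -> f s1 = f s2.

(* The sum over the lattice is the library's finitely supported sum (zero by
   convention if the support is infinite): for local [f] only the finitely many
   sites on which [f] depends contribute. *)
Definition L1 B f : Omega d -> R :=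
  fun s => \sum_(i \in [set: lattice d]) spin_prod B i s * nabla i f s.

Definition spinflip_op BB lam f : Omega d -> R :=
  fun s => \sum_(B <- BB) lam B * L1 B f s.

Definition rate BB lam i s : R := \sum_(B <- BB) lam B * spin_prod B i s.

Definition positive_rates BB lam : Prop :=
  0 < inf [set rate BB lam p.1 p.2 | p in [set: lattice d * Omega d]].

(* [sup] returns 0 on unbounded sets, but [supnorm] is only applied to
   continuous, hence bounded, functions. *)
Definition supnorm f : R := sup [set `|f s| | s in [set: Omega d]].

(* Markov (Feller) semigroups on the space of continuous functions; the values
   of [S t f] for [t < 0] or [f] not continuous are irrelevant. *)
Record markov_semigroup (S : R -> (Omega d -> R) -> (Omega d -> R)) : Prop := {
  msg_continuous : forall t f, 0 <= t -> continuous f -> continuous (S t f);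
  msg_linear : forall t (a : R) f g, 0 <= t -> continuous f -> continuous g ->
    S t (fun s => a * f s + g s) = (fun s => a * S t f s + S t g s);
  msg_id : forall f, continuous f -> S 0 f = f;
  msg_right_continuous : forall t f, 0 <= t -> continuous f ->
    supnorm (fun s => S u f s - S t f s) @[u --> t^'+] --> (0 : R);
  msg_comp : forall t u f, 0 <= t -> 0 <= u -> continuous f ->
    S (t + u) f = S t (S u f);
  msg_one : forall t, 0 <= t -> S t (fun=> 1) = (fun=> 1);
  msg_ge0 : forall t f, 0 <= t -> continuous f ->
    (forall s, 0 <= f s) -> forall s, 0 <= S t f s
}.

(* Unbounded operators are represented by their graphs. *)
Definition semigroup_generator (S : R -> (Omega d -> R) -> (Omega d -> R)) f g
    : Prop :=
  [/\ continuous f, continuous g &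
    supnorm (fun s => (S t f s - f s) / t - g s) @[t --> 0^'+] --> (0 : R)].

(* The closure, for the product of the supremum norms, of the graph of
   [spinflip_op] on local functions. *)
Definition spinflip_closure BB lam f g : Prop :=
  [/\ continuous f, continuous g & forall e : R, 0 < e -> exists h,
    [/\ local h, supnorm (fun s => h s - f s) < e &
        supnorm (fun s => spinflip_op BB lam h s - g s) < e]].

Definition spinflip_semigroup BB lam S : Prop :=
  markov_semigroup S /\
  forall f g, semigroup_generator S f g <-> spinflip_closure BB lam f g.

(* [mut] is the measure mu S(t). *)
Definition evolved (S : R -> (Omega d -> R) -> (Omega d -> R)) (t : R)
    (mu mut : probability (borelOmega d) R) : Prop :=
  forall f, continuous f ->
    (\int[mut]_s (f s)%:E = \int[mu]_s (S t f s)%:E)%E.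

(* A measure of the library is a function on all sets, unconstrained outside the
   sigma-algebra, so equality of measures is tested on Borel sets only. *)
Definition same_measure (mu nu : probability (borelOmega d) R) : Prop :=
  forall A : set (borelOmega d), measurable A -> mu A = nu A.

End SpinFlip.

(* Main.v *)
Require Import Defs.
From mathcomp Require Import all_boot all_order all_algebra finmap.
From mathcomp Require Import all_classical all_reals all_analysis.
From mathcomp Require Import ring lra.
Import Order.TTheory GRing.Theory Num.Theory numFieldNormedType.Exports.
Local Open Scope classical_set_scope.
Local Open Scope ring_scope.

Set Implicit Arguments.
Unset Strict Implicit.
Unset Printing Implicit Defensive.

(** Put phi_r(u) := int S(u) sigma_r dmu - int S(u) sigma_r dnu for a spin
    monomial sigma_r.  If mu S(t) = nu S(t), every phi_r vanishes at u = t.  The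
    generator sends sigma_r to a combination, with total weight at most
    2 (sum |lambda|) |r|, of monomials of degree at most |r| + const, so the
    n-th derivative of phi_r grows at most like n! kappa^n: the functions phi_r
    are analytic with a radius of convergence that does not depend on r.  Hence
    they vanish on [t - delta, t] with a uniform delta, and, repeating the
    argument, at u = 0.  So mu and nu integrate all monomials to the same
    values, and these determine a measure on the Borel sets of the product
    space. *)

(** * Cylinders, continuous functions and Borel sets of the configuration space *)

Section Topology.
Context {d : nat}.
Implicit Types (s : Omega d) (i : lattice d) (r : seq (lattice d)).

Definition agree r s : set (Omega d) :=
  [set s' : Omega d | forall j, j \in r -> s' j = s j].

Lemma nbhs_agree r s : nbhs s (agree r s).
Proof.
elim: r => [|i r IHr]; first by apply: filterS filterT => s' _ j; rewrite in_nil.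
have ni : nbhs s [set s' : Omega d | s' i = s i].
  apply: (@proj_continuous (lattice d) (fun _ => bool) i s [set s i]).
  exact: discrete_set1.
apply: filterS (filterI ni IHr) => s' [si sr] j; rewrite inE => /predU1P[->//|].
exact: sr.
Qed.

(** The cylinders around [s] generate a filter that converges to [s] in every coordinate, hence in
    the product topology. *)
Lemma nbhs_agreeP s (U : set (Omega d)) :
  nbhs s U -> exists r, agree r s `<=` U.
Proof.
pose F : set_system (Omega d) := filter_from [set: seq (lattice d)] (agree ^~ s).
have FF : Filter F.
  apply: filter_from_filter; first by exists [::].
  move=> r1 r2 _ _; exists (r1 ++ r2) => // s' s's.
  by split=> j jr; apply: s's; rewrite mem_cat jr ?orbT.
have Fs : F --> s.
  apply/cvg_sup => i; apply/cvg_image.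
    by rewrite -subTset => b _; exists (fun=> b).
  move=> V /= Vsi; exists [set s' : Omega d | V (s' i)].
    exists [:: i] => // s' s's /=.
    by rewrite (s's i) ?inE//; exact: nbhs_singleton Vsi.
  rewrite eqEsubset; split => [b [s' /= Vs' <-]//|b Vb].
  by exists (fun=> b).
by move=> /Fs [r _ rU]; exists r.
Qed.

Lemma compact_Omega : compact [set: Omega d].
Proof.
have -> : [set: Omega d] = [set f | forall i : lattice d, [set: bool] (f i)].
  by rewrite eqEsubset; split.
have cT : forall i : lattice d, compact [set: bool].
  by move=> _; apply: finite_compact; exact: finite_finset.
exact: (@tychonoff (lattice d) (fun _ => bool) (fun _ => [set: bool]) cT).
Qed.

Context {R : realType}.
Implicit Types f : Omega d -> R.

Lemma continuous_ubound f : continuous f -> exists c, forall s, `|f s| <= c.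
Proof.
move=> cf; have /compact_bounded [M [_ HM]] : compact (f @` [set: Omega d]).
  apply: continuous_compact; last exact: compact_Omega.
  exact: continuous_subspaceT.
exists (M + 1) => s; apply: HM; first by rewrite ltrDl.
by exists s.
Qed.

Lemma ler_supnorm f s : continuous f -> `|f s| <= supnorm f.
Proof.
move=> /continuous_ubound [c fc]; apply: sup_ubound; last by exists s.
by exists c => _ [s' _ <-].
Qed.

Lemma continuous_local f : local f -> continuous f.
Proof.
move=> [A fA] s U /= /nbhs_singleton Us.
apply: filterS (nbhs_agree A s) => s' s's /=.
by rewrite (fA _ s).
Qed.

Lemma measurable_continuous f :
  continuous f -> measurable_fun [set: borelOmega d] (f : borelOmega d -> R).
Proof.
move=> /continuousP cf; apply:
  (measurability _ (measurable_realfun.RGenOpens.measurableE R)).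
move=> _ [_ [a [b ->]] <-]; rewrite setTI; apply: sub_sigma_algebra.
by apply: cf; exact: interval_open.
Qed.

Lemma integrable_continuous (mu : probability (borelOmega d) R) f :
  continuous f -> mu.-integrable [set: borelOmega d] (EFin \o f).
Proof.
move=> cf; apply: measurable_bounded_integrable => //.
- exact: le_lt_trans (probability_le1 mu measurableT) (ltry 1).
- exact: measurable_continuous.
- have [c fc] := continuous_ubound cf.
  exists c; split=> [|M cM s _]; first exact: num_real.
  exact: le_trans (fc s) (ltW cM).
Qed.

(** These sets form a pi-system and their indicators are polynomials in the spins, so they lead from
    monomials to measures. *)
Definition up r : set (Omega d) := [set s : Omega d | forall j, j \in r -> s j].

Lemma up_cat r1 r2 : up (r1 ++ r2) = up r1 `&` up r2.
Proof.
rewrite eqEsubset; split=> s.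
  by move=> s12; split=> j jr; apply: s12; rewrite mem_cat jr ?orbT.
move=> [s1 s2] j; rewrite mem_cat => /orP[]; [exact: s1|exact: s2].
Qed.

Lemma up_agree r s : up r s -> agree r s `<=` up r.
Proof. by move=> sr t st j jr; rewrite st// sr. Qed.

Lemma open_up r : open (up r).
Proof.
rewrite openE => s sr; apply: filterS (nbhs_agree r s).
exact: up_agree.
Qed.

(** Each site contributes either [up [:: i]] or its complement, according to the spin of [s]
    there. *)
Lemma sigma_up_agree r s : <<s range up >> (agree r s).
Proof.
elim: r => [|i r IHr].
  have -> : agree [::] s = up [::] by rewrite eqEsubset; split.
  by apply: sub_sigma_algebra; exists [::].
have -> : agree (i :: r) s =
    (if s i then up [:: i] else ~` up [:: i]) `&` agree r s.
  rewrite eqEsubset; split=> t.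
    move=> st; split; last by move=> j jr; apply: st; rewrite inE jr orbT.
    have := st i; rewrite mem_head => /(_ isT).
    case: (s i) => ti; first by move=> j; rewrite inE => /eqP ->; rewrite ti.
    by move=> /(_ i); rewrite mem_head ti => /(_ isT).
  move=> [ti st] j; rewrite inE => /predU1P[->|]; last exact: st.
  case: (s i) ti => [|Nti]; first by apply; rewrite mem_head.
  apply/negbTE/negP => tj; apply: Nti => k.
  by rewrite inE => /eqP ->.
pose T := g_sigma_algebraType (range up).
have uT : measurable (up [:: i] : set T).
  by apply: sub_sigma_algebra; exists [:: i].
have aT : measurable (agree r s : set T) by [].
suff: measurable ((if s i then up [:: i] else ~` up [:: i]) `&` agree r s : set T).
  by [].
by apply: measurableI => //; case: (s i) => //; exact: measurableC.
Qed.

(** The lattice is countable, so there are only countably many cylinders and every open set is a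
    countable union of them. *)
Lemma measurable_Omega : @measurable _ (borelOmega d) = <<s range up >>.
Proof.
rewrite eqEsubset; split; apply: smallest_sub; try exact: smallest_sigma_algebra.
  move=> U oU.
  pose T := g_sigma_algebraType (range up).
  (* A cylinder is coded by its constrained sites and a list that singles out those with spin +1;
     such codes form a countable type. *)
  pose C (p : seq (lattice d) * seq (lattice d)) : set T :=
    agree p.1 (fun j => j \in p.2).
  pose P := [set p | C p `<=` U].
  have -> : U = \bigcup_p (if p \in P then C p else set0).
    rewrite eqEsubset; split=> s.
      move=> Us; have [r rU] := nbhs_agreeP (open_nbhs_nbhs (conj oU Us)).
      pose p := (r, [seq j <- r | s j]).
      have sp : agree r s = C p.
        by rewrite eqEsubset; split=> t st j jr; rewrite st//= mem_filter jr andbT.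
      by exists p => //; rewrite ifT -?sp// inE /P/= -sp.
    by move=> [p _]; case: ifPn => // /set_mem pP /pP.
  apply: (@countable_bigcupT_measurable _ T) => [|p]; first exact: countableP.
  by case: ifP => // _; exact: sigma_up_agree.
move=> _ [r _ <-]; apply: sub_sigma_algebra; exact: open_up.
Qed.

(** Uniqueness of measures on a generating pi-system; [up [::]] is the whole space, of finite
    mass. *)
Lemma same_measure_up (mu nu : probability (borelOmega d) R) :
  (forall r, mu (up r) = nu (up r)) -> same_measure mu nu.
Proof.
move=> munu A mA.
apply: (@measure_unique _ R (borelOmega d) (range up) (fun=> up [::])) => //.
- exact: measurable_Omega.
- move=> _ _ [r1 _ <-] [r2 _ <-]; exists (r1 ++ r2) => //; exact: up_cat.
- by rewrite -subTset => s _; exists 0%N.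
- by move=> _ [r _ <-]; exact: munu.
- move=> _; apply: le_lt_trans (probability_le1 _ _) (ltry 1).
  by apply: sub_sigma_algebra; exact: open_up.
Qed.

End Topology.

(** * A discrete substitute for integrating a derivative bound *)

Section EulerScheme.
Context {R : realType}.

(** A Bernoulli inequality: one step of the power function dominates its linear part, which makes
    the Euler induction close. *)
Lemma bernoulli_exprD (x h : R) n : 0 <= x -> 0 <= h ->
  x ^+ n.+1 + h * (n.+1%:R * x ^+ n) <= (x + h) ^+ n.+1.
Proof.
move=> x0 h0; elim: n => [|n IHn]; first by rewrite !expr1 expr0 !mulr1.
rewrite [leRHS]exprS; apply: le_trans (ler_wpM2l (addr_ge0 x0 h0) IHn).
rewrite -subr_ge0 (_ : _ - _ = h * h * (n.+1%:R * x ^+ n)).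
  by rewrite !mulr_ge0 ?exprn_ge0.
by rewrite [n.+2%:R]mulrS !exprS; ring.
Qed.

(* The increments of [phi] are compared with those of [(b - u) ^+ n.+1] along
   the Euler scheme run backwards from [b]; no regularity beyond the uniform
   first-order expansion is needed. *)
Lemma euler_bound (phi psi : R -> R) (a b C : R) (n : nat) :
  0 <= C -> a <= b -> phi b = 0 ->
  (forall e, 0 < e -> exists2 h0, 0 < h0 & forall h u, 0 < h < h0 -> a <= u ->
    `|phi (u + h) - phi u - h * psi u| <= e * h) ->
  (forall u, a <= u <= b -> `|psi u| <= C * (n.+1%:R * (b - u) ^+ n)) ->
  `|phi a| <= C * (b - a) ^+ n.+1.
Proof.
move=> C0 ab phib dphi psiB.
(* The bound carries [k.+1] after [k] steps because [psi] is estimated at the left end of each step,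
   where its bound is larger; the surplus [h] absorbs the excess. *)
have step e h0 h : 0 < e ->
    (forall h u, 0 < h < h0 -> a <= u ->
      `|phi (u + h) - phi u - h * psi u| <= e * h) ->
    0 < h < h0 -> forall k, a <= b - k%:R * h ->
    `|phi (b - k%:R * h)| <= C * (k.+1%:R * h) ^+ n.+1 + e * (k%:R * h).
  move=> e0 H hh0; have /andP[h_gt0 _] := hh0; elim=> [|k IHk] ak.
    rewrite mul0r subr0 phib normr0 mulr0 addr0 mulr_ge0// exprn_ge0//.
    by rewrite mulr_ge0// ltW.
  set u := b - _ in ak *.
  have uh : u + h = b - k%:R * h by rewrite /u -natr1; ring.
  have := IHk; rewrite -uh => /(_ (le_trans ak _)).
  rewrite lerDl ltW// => /(_ isT) IH.
  have bu : b - u = k.+1%:R * h by rewrite /u; ring.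
  have kh0 : 0 <= k.+1%:R * h by rewrite mulr_ge0// ltW.
  have := psiB u; rewrite ak/= bu -subr_ge0 bu kh0 => /(_ isT) Pu.
  have := ler_wpM2l C0 (bernoulli_exprD n kh0 (ltW h_gt0)).
  have -> : k.+1%:R * h + h = k.+2%:R * h by rewrite -[in RHS]natr1; ring.
  have := H h u hh0 ak.
  have := ler_wpM2l (ltW h_gt0) Pu; rewrite -[h in h * `|_|]gtr0_norm// -normrM.
  move=> B1 B2 B3.
  have {B2} : `|phi u| <= `|phi (u + h)| + e * h + `|h * psi u|.
    rewrite [phi u](_ : _ =
      phi (u + h) - (phi (u + h) - phi u - h * psi u) - h * psi u); last by ring.
    apply: (le_trans (ler_normB _ _)); rewrite lerD2r.
    by apply: (le_trans (ler_normB _ _)); rewrite lerD2l.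
  have -> : e * (k.+1%:R * h) = e * (k%:R * h) + e * h by rewrite -natr1; ring.
  by lra.
have [->|ab'] := eqVneq a b.
  by rewrite phib normr0 mulr_ge0// exprn_ge0// subrr.
have {}ab : 0 < b - a by rewrite subr_gt0 lt_neqAle ab'.
apply/ler_addgt0Pr => e e0.
have cont : C * (b - a + h) ^+ n.+1 @[h --> (0 : R)] --> C * (b - a) ^+ n.+1.
  have bah : b - a + h @[h --> (0 : R)] --> b - a + 0.
    by apply: cvgD; [exact: cvg_cst|exact: cvg_id].
  rewrite addr0 in bah; apply: cvgMr.
  apply: (cvg_comp (fun h : R => b - a + h) (fun x => x ^+ n.+1) bah).
  exact: exprn_continuous.
(* Half of [e] pays for the surplus step, half for the first-order errors, which accumulate at rate
   [e / 2 / (b - a)] over a length [b - a]. *)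
have e2 : 0 < e / 2 by rewrite divr_gt0.
have /cvgrPdist_le /(_ _ e2) /nbhs_ballP [r /= r0 rB] := cont.
have [h0 h00 H] := dphi _ (divr_gt0 e2 ab).
pose m := Num.min r h0.
have m0 : 0 < m by rewrite lt_min r0.
(* Enough steps for the length [(b - a) / N] to fall below [m] while [N] of them reach [a] from
   [b]. *)
pose N := (Num.truncn ((b - a) / m)).+1.
have N0 : 0 < N%:R :> R by rewrite ltr0n.
pose h := (b - a) / N%:R.
have h_gt0 : 0 < h by rewrite divr_gt0.
have hm : h < m.
  rewrite /h ltr_pdivrMr// mulrC -ltr_pdivrMr//.
  exact: truncnS_gt.
have Nh : N%:R * h = b - a by rewrite /h mulrC divfK// gt_eqF.
have := step _ _ h (divr_gt0 e2 ab) H _ N.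
rewrite Nh (_ : b - (b - a) = a); last by ring.
rewrite h_gt0 (lt_le_trans hm) ?ge_min ?lexx ?orbT//.
move=> /(_ isT isT).
move/le_trans; apply.
have rh : ball (0 : R) r h.
  by rewrite /ball/= sub0r normrN gtr0_norm// (lt_le_trans hm)// ge_min lexx.
have := rB h rh; rewrite /=.
rewrite -natr1 mulrDl Nh mul1r divfK ?gt_eqF// ler_distlC => /andP[_].
rewrite (addrC h) => hC; rewrite [e in leRHS]splitr addrA lerD2r; exact: hC.
Qed.
End EulerScheme.

(** * Spin monomials and the action of the generator on them *)

Section Monomials.
Context {R : realType} {d : nat}.
Implicit Types (s : Omega d) (i : lattice d) (r : seq (lattice d)).
Implicit Types (f g : Omega d -> R).
Implicit Types (BB : {fset {fset lattice d}}) (lam : {fset lattice d} -> R).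

(* Sites of [r] may repeat, so that a product of monomials is the monomial of
   the concatenation. *)
Definition mono r s : R := \prod_(j <- r) spin s j.

Lemma mono_cat r1 r2 s : mono (r1 ++ r2) s = mono r1 s * mono r2 s.
Proof. exact: big_cat. Qed.

Lemma mono_cons i r s : mono (i :: r) s = spin s i * mono r s.
Proof. exact: big_cons. Qed.

Lemma mono_norm r s : `|mono r s| = 1.
Proof.
rewrite normr_prod big1 // => j _.
by rewrite /spin; case: (s j); rewrite ?normrN1 ?normr1.
Qed.

Lemma spin_flip s i j : spin (flip s i) j = (-1) ^+ (j == i) * spin s j :> R.
Proof.
by rewrite /spin /flip; case: eqP => _; case: (s j); rewrite /= ?mul1r ?mulN1r ?opprK.
Qed.

Lemma mono_flip r s i : mono r (flip s i) = (-1) ^+ count_mem i r * mono r s.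
Proof.
elim: r => [|j r IHr]; first by rewrite /mono !big_nil mul1r.
by rewrite !mono_cons IHr spin_flip /= exprD mulrACA.
Qed.

Lemma local_mono r : local (mono r).
Proof.
exists [fset j | j in r]%fset => s1 s2 s12; apply: eq_big_seq => j jr.
by rewrite /spin s12// in_fset.
Qed.

Lemma continuous_mono r : continuous (mono r).
Proof. exact: continuous_local (local_mono r). Qed.

Lemma continuous_lincomb (I : Type) (l : seq I) (c : I -> R)
    (F : I -> Omega d -> R) :
  (forall x, continuous (F x)) ->
  continuous (fun s => \sum_(x <- l) c x * F x s).
Proof.
move=> cF; elim: l => [|x l IHl].
  rewrite (_ : (fun _ => _) = (fun=> 0)); last first.
    by apply/funext => s; rewrite big_nil.
  exact: cst_continuous.
rewrite (_ : (fun _ => _) = (fun s => c x * F x s + \sum_(y <- l) c y * F y s)).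
  move=> s; apply: cvgD; last exact: IHl.
  by apply: cvgM; [exact: cvg_cst|exact: cF].
by apply/funext => s; rewrite big_cons.
Qed.

(** Only flips at sites of [r] can change the monomial; [undup] counts a repeated site once, as the
    sum over the lattice does. *)
Definition terms BB r := [seq (B, i) | B <- enum_fset BB, i <- undup r].

(** The sign factor is -2 at a site of odd multiplicity in [r] and 0 otherwise. *)
Definition term_coef lam r (p : {fset lattice d} * lattice d) : R :=
  lam p.1 * ((-1) ^+ count_mem p.2 r - 1).

Definition term_sites r (p : {fset lattice d} * lattice d) :=
  [seq j + p.2 | j <- p.1] ++ r.

(** Every flip multiplies a monomial by a sign, so [nabla i] acts on it as a scalar, and the factor
    [spin_prod B i] only appends the sites of a translate of [B]. *)
Lemma spinflip_op_mono BB lam r : spinflip_op BB lam (mono r) =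
  (fun s => \sum_(p <- terms BB r) term_coef lam r p * mono (term_sites r p) s).
Proof.
apply/funext => s; rewrite /spinflip_op /terms big_allpairs.
apply: eq_bigr => B _; rewrite /L1 -(fsbig_widen [set` undup r]) //; last first.
  move=> i [_ /= /negP]; rewrite mem_undup => ir.
  by rewrite /nabla mono_flip (count_memPn ir) expr0 mul1r subrr mulr0.
rewrite -fsbig_seq ?undup_uniq// big_distrr; apply: eq_bigr => i _ /=.
rewrite /nabla mono_flip mono_cat /term_coef /= /spin_prod.
by rewrite [X in _ = _ * (X * _)]big_map; ring.
Qed.

(** The growth is only linear in [size r]; this is what keeps the iterated derivatives at factorial
    order. *)
Lemma sum_term_coef BB lam r :
  \sum_(p <- terms BB r) `|term_coef lam r p| <=
  2 * (\sum_(B <- BB) `|lam B|) * (size r)%:R.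
Proof.
rewrite big_allpairs mulrAC mulr_sumr; apply: ler_sum => B _.
under eq_bigr do rewrite normrM /=.
rewrite -mulr_sumr mulrC ler_wpM2r//.
apply: (@le_trans _ _ (\sum_(i <- undup r) 2)).
  apply: ler_sum => i _; apply: (le_trans (ler_normB _ _)).
  by rewrite normrX normrN1 expr1n normr1.
by rewrite big_const_seq count_predT iter_addr_0 mulr_natr ler_pMn2l ?size_undup.
Qed.

Lemma size_term_sites BB r p : p \in terms BB r ->
  (size (term_sites r p) <= size r + \sum_(B <- BB) #|` B|)%N.
Proof.
case/allpairsP => -[B i] /= [BBB _ ->]; rewrite size_cat size_map addnC leq_add2l.
by rewrite (big_rem B)//= leq_addr.
Qed.

End Monomials.

(** * Bounded functionals and their determination by monomials *)

Section Injectivity.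
Context {R : realType} {d : nat}.
Implicit Types (s : Omega d) (i : lattice d) (r : seq (lattice d)).
Implicit Types (f g : Omega d -> R) (rho : (Omega d -> R) -> R) (t u e h : R).

(** Stands in for a signed measure of total variation at most [M]; the class is stable under
    composition with [S t]. *)
Record bounded_functional (M : R) rho : Prop := {
  bfun_linear : forall (a : R) f g, continuous f -> continuous g ->
    rho (fun s => a * f s + g s) = a * rho f + rho g;
  bfun_bound : forall (c : R) f, continuous f -> (forall s, `|f s| <= c) ->
    `|rho f| <= M * c
}.

Lemma bfun_lincomb M rho (I : Type) (l : seq I) (c : I -> R)
    (F : I -> Omega d -> R) :
  bounded_functional M rho -> (forall x, continuous (F x)) ->
  rho (fun s => \sum_(x <- l) c x * F x s) = \sum_(x <- l) c x * rho (F x).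
Proof.
move=> [lin _] cF; have c0 : continuous (fun _ : Omega d => 0 : R).
  exact: cst_continuous.
elim: l => [|x l IHl].
  (* Linearity applied to this form of the zero function gives [- rho 0 + rho 0]. *)
  rewrite big_nil; transitivity (rho (fun s => -1 * 0 + 0)).
    by congr rho; apply/funext => s; rewrite big_nil mulr0 addr0.
  by rewrite lin// mulN1r addNr.
rewrite big_cons -IHl -lin//; last exact: continuous_lincomb.
by congr rho; apply/funext => s; rewrite big_cons.
Qed.

Lemma mono_half_cons q i r s :
  mono q s * \prod_(j <- i :: r) ((1 + spin s j) / 2) =
  2^-1 * (mono q s * \prod_(j <- r) ((1 + spin s j) / 2)) +
  2^-1 * (mono (i :: q) s * \prod_(j <- r) ((1 + spin s j) / 2)) :> R.
Proof. by rewrite big_cons mono_cons; ring. Qed.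

Lemma continuous_half_prod r :
  continuous (fun s => \prod_(j <- r) ((1 + spin s j) / 2) : R).
Proof.
apply: continuous_local; exists [fset j | j in r]%fset => s1 s2 s12.
by apply: eq_big_seq => j jr; rewrite /spin s12// in_fset.
Qed.

Lemma indic_upE r s :
  \1_(up r) s = \prod_(j <- r) ((1 + spin s j) / 2) :> R.
Proof.
rewrite indicE; have [|] := pselect (up r s) => sr.
  rewrite mem_set// big_seq big1// => j jr.
  by rewrite /spin (sr j jr) divff.
rewrite memNset//.
have /existsNP[j /not_implyP[jr /negP sj]] := sr.
by rewrite (big_rem j)//= /spin (negbTE sj) subrr mul0r mul0r.
Qed.

Lemma bfun_indic_up0 M rho r : bounded_functional M rho ->
  (forall r, rho (mono r) = 0) -> rho (\1_(up r)) = 0.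
Proof.
move=> rhoP rho0.
(* The additional monomial makes the induction work: expanding one factor either drops its site or
   moves it into [q]. *)
suff H q : rho (fun s => mono q s * \prod_(j <- r) ((1 + spin s j) / 2)) = 0.
  rewrite -(H [::]); congr rho; apply/funext => s.
  by rewrite indic_upE /mono big_nil mul1r.
have cP q' r' : continuous (fun s => mono q' s *
    \prod_(j <- r') ((1 + spin s j) / 2) : R).
  by move=> s; apply: cvgM; [exact: continuous_mono|exact: continuous_half_prod].
elim: r q => [|i r IHr] q.
  rewrite -[RHS](rho0 q); congr rho; apply/funext => s.
  by rewrite big_nil mulr1.
pose F (b : bool) := fun s =>
  mono (if b then q else i :: q) s * \prod_(j <- r) ((1 + spin s j) / 2) : R.
have -> : (fun s => mono q s * \prod_(j <- i :: r) ((1 + spin s j) / 2)) =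
    (fun s => \sum_(b <- [:: true; false]) 2^-1 * F b s).
  by apply/funext => s; rewrite mono_half_cons !big_cons big_nil addr0.
rewrite (bfun_lincomb _ _ rhoP); last by case; exact: cP.
by rewrite !big_cons big_nil /F !IHr !mulr0 !addr0.
Qed.

Lemma bfun_Rintegral (mu : probability (borelOmega d) R) :
  bounded_functional 1 (fun f => \int[mu]_s f s).
Proof.
split=> [a f g cf cg|c f cf fc].
  have af : continuous (fun s => a * f s).
    by move=> s; apply: cvgM; [exact: cvg_cst|exact: cf].
  rewrite RintegralD ?RintegralZl//; exact: integrable_continuous.
have ic : mu.-integrable setT (EFin \o (fun=> c)).
  by apply: integrable_continuous => s; exact: cvg_cst.
have mf := integrable_continuous mu cf.
apply: (le_trans (le_normr_Rintegral _ mf)) => //.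
apply: (@le_trans _ _ (\int[mu]_s (fun=> c) s)).
  apply: le_Rintegral => //; exact: (integrable_norm mf).
rewrite Rintegral_cst//= probability_setT mulrC//.
Qed.

End Injectivity.

(** * Analyticity in time and propagation of zeros backwards *)

Section Semigroup.
Context {R : realType} {d : nat}.
Variables (BB : {fset {fset lattice d}}) (lam : {fset lattice d} -> R).
Variable S : R -> (Omega d -> R) -> (Omega d -> R).
Hypothesis hS : spinflip_semigroup BB lam S.
Implicit Types (s : Omega d) (i : lattice d) (r : seq (lattice d)).
Implicit Types (f g : Omega d -> R) (rho : (Omega d -> R) -> R) (t u e h : R).

Let S_markov : markov_semigroup S := proj1 hS.

Lemma semigroup_cst t (c : R) : 0 <= t -> S t (fun=> c) = (fun=> c).
Proof.
move=> t0; have c1 : continuous (fun _ : Omega d => 1 : R).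
  exact: cst_continuous.
have := msg_linear S_markov (c - 1) t0 c1 c1.
rewrite msg_one// => E; transitivity (S t (fun=> (c - 1) * 1 + 1)).
  by congr (S t); apply/funext => s; ring.
by rewrite E; apply/funext => s; ring.
Qed.

(** Positivity is applied to [c + f] and [c - f], constants being preserved. *)
Lemma semigroup_contract t f (c : R) : 0 <= t -> continuous f ->
  (forall s, `|f s| <= c) -> forall s, `|S t f s| <= c.
Proof.
move=> t0 cf fc s.
have cc : continuous (fun _ : Omega d => c : R) by exact: cst_continuous.
have pos (a : R) : `|a| = 1 -> 0 <= a * S t f s + c.
  move=> a1; have := msg_linear S_markov a t0 cf cc.
  rewrite semigroup_cst// => /(congr1 (@^~ s)) /= <-.
  apply: msg_ge0 => // [s'|s'].
    apply: cvgD; last exact: cvg_cst.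
    by apply: cvgM; [exact: cvg_cst|exact: cf].
  have : `|a * f s'| <= c by rewrite normrM a1 mul1r.
  by rewrite ler_norml => /andP[]; lra.
have := pos 1; have := pos (-1); rewrite normrN1 normr1 ler_norml.
by move=> /(_ erefl) ? /(_ erefl) ?; apply/andP; split; lra.
Qed.

Lemma bfun_semigroup M rho t : 0 <= t -> bounded_functional M rho ->
  bounded_functional M (rho \o S t).
Proof.
move=> t0 [lin bnd]; split=> [a f g cf cg|c f cf fc] /=.
  by rewrite msg_linear// lin//; apply: msg_continuous.
by apply: bnd; [exact: msg_continuous|exact: semigroup_contract].
Qed.

(** A monomial is local, hence its own approximation in the closure of the graph. *)
Lemma generator_mono r :
  semigroup_generator S (mono r) (spinflip_op BB lam (mono r)).
Proof.
have sup0 (f : Omega d -> R) : supnorm (fun s => f s - f s) = 0.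
  rewrite /supnorm (_ : [set _ | _ in _] = [set 0]) ?sup1//.
  rewrite eqEsubset; split=> [_ [s _ <-]|_ ->].
    by rewrite subrr normr0.
  by exists point => //; rewrite subrr normr0.
apply/(proj2 hS); split.
- exact: continuous_mono.
- rewrite spinflip_op_mono; apply: continuous_lincomb => p.
  exact: continuous_mono.
- by move=> e e0; exists (mono r); rewrite !sup0; split=> //; exact: local_mono.
Qed.

Lemma mono_expansion r e : 0 < e -> exists2 h0, 0 < h0 &
  forall h, 0 < h < h0 -> forall s,
  `|S h (mono r) s - mono r s - h * spinflip_op BB lam (mono r) s| <= e * h.
Proof.
move=> e0; have [cm cL] := generator_mono r.
move=> /cvgrPdist_le /(_ _ e0) /=; rewrite /at_right => -[h0 /= h00 H].
exists h0 => // h /andP[h_gt0 hh0] s.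
have := H h; rewrite /ball_ /= sub0r !normrN gtr0_norm// => /(_ hh0 h_gt0).
set D := (X in supnorm X) => HD.
(* Continuity bounds [D], so that [supnorm D] is a true supremum and not the default value 0. *)
have cD : continuous D.
  move=> s'; apply: cvgB; last exact: cL.
  apply: cvgM; last exact: cvg_cst.
  apply: cvgB; last exact: cm.
  by apply: (msg_continuous S_markov) => //; exact: ltW.
have -> : S h (mono r) s - mono r s - h * spinflip_op BB lam (mono r) s = D s * h.
  by rewrite /D mulrBl divfK ?gt_eqF// [h * _]mulrC.
rewrite normrM (gtr0_norm h_gt0) ler_wpM2r ?(ltW h_gt0)//.
apply: le_trans (ler_supnorm s cD) _.
by apply: le_trans (ler_norm _) _; rewrite -normrN -sub0r.
Qed.

(** By the semigroup law the expansion at time 0 is carried to time [u] by [rho \o S u], which has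
    the same bound [M]; hence [h0] does not depend on [u]. *)
Lemma bfun_expansion M rho r e : 0 <= M -> bounded_functional M rho ->
  0 < e -> exists2 h0, 0 < h0 & forall h u, 0 < h < h0 -> 0 <= u ->
  `|rho (S (u + h) (mono r)) - rho (S u (mono r)) -
    h * \sum_(p <- terms BB r)
          term_coef lam r p * rho (S u (mono (term_sites r p)))| <= e * h.
Proof.
(* The error is divided by [M + 1] since [M] may be 0. *)
move=> M0 rhoP e0; have M1 : 0 < M + 1 by rewrite ltr_wpDl.
have [h0 h00 H] := mono_expansion r (divr_gt0 e0 M1).
exists h0 => // h u hh0 u0; have /andP[h_gt0 _] := hh0.
have rhoSP := bfun_semigroup u0 rhoP.
have cS : continuous (S h (mono r)).
  by apply: (msg_continuous S_markov); [exact: ltW|exact: continuous_mono].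
have cm := @continuous_mono R d r.
have cL : continuous (spinflip_op BB lam (mono r)).
  rewrite spinflip_op_mono; apply: continuous_lincomb => p.
  exact: continuous_mono.
have LE : \sum_(p <- terms BB r)
    term_coef lam r p * rho (S u (mono (term_sites r p))) =
    rho (S u (spinflip_op BB lam (mono r))).
  rewrite spinflip_op_mono -[RHS]/((rho \o S u) _) (bfun_lincomb _ _ rhoSP)//.
  by move=> p; exact: continuous_mono.
rewrite LE (msg_comp S_markov) ?(ltW h_gt0)//.
have cB : continuous (fun s => -1 * mono r s + S h (mono r) s).
  move=> s; apply: cvgD; last exact: cS.
  by apply: cvgM; [exact: cvg_cst|exact: cm].
have -> : rho (S u (S h (mono r))) - rho (S u (mono r)) -
    h * rho (S u (spinflip_op BB lam (mono r))) =
    (rho \o S u) (fun s => - h * spinflip_op BB lam (mono r) s +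
      (-1 * mono r s + S h (mono r) s)).
  by rewrite !(bfun_linear rhoSP)//=; ring.
apply: le_trans (bfun_bound rhoSP (c := e / (M + 1) * h) _ _) _.
- move=> s; apply: cvgD; last exact: cB.
  by apply: cvgM; [exact: cvg_cst|exact: cL].
- move=> s; rewrite (_ : - h * _ + _ =
    S h (mono r) s - mono r s - h * spinflip_op BB lam (mono r) s); last by ring.
  exact: H.
- rewrite mulrA ler_wpM2r ?(ltW h_gt0)// mulrCA ger_pMr// ler_pdivrMr// mul1r.
  by rewrite lerDl.
Qed.

Let Lam : R := \sum_(B <- BB) `|lam B|.
(** Bounds the number of sites appended by one application of the generator; the successor keeps it
    positive, so that [K * i.+1] can exceed any size. *)
Let K : nat := (\sum_(B <- BB) #|` B|).+1.
(** A monomial of size at most [K * i.+1] is sent to a combination of total weight at most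
    [kappa * i.+1]. *)
Let kappa : R := 2 * Lam * K%:R.

Lemma kappa_ge0 : 0 <= kappa.
Proof. by rewrite !mulr_ge0 ?sumr_ge0. Qed.

(* Cauchy-Kovalevskaya estimate: each derivative enlarges the support by a
   bounded amount, so the [n]-th one costs only the binomial ['C(i + n, n)]
   times [n`! * kappa ^+ n], and [n`!] is cancelled by integration. *)
Lemma taylor_bound M rho b (n i : nat) r u :
  0 <= M -> bounded_functional M rho ->
  (forall r, rho (S b (mono r)) = 0) ->
  (size r <= K * i.+1)%N -> 0 <= u <= b ->
  `|rho (S u (mono r))| <= M * 'C(i + n, n)%:R * kappa ^+ n * (b - u) ^+ n.
Proof.
move=> M0 rhoP rhob; have k0 := kappa_ge0.
elim: n i r u => [|n IHn] i r u rK /andP[u0 ub].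
  rewrite bin0 !expr0 !mulr1 -[leRHS]mulr1.
  apply: (bfun_bound (bfun_semigroup u0 rhoP)); first exact: continuous_mono.
  by move=> s; rewrite mono_norm.
apply: (@euler_bound _ (fun v => rho (S v (mono r))) (fun v =>
  \sum_(p <- terms BB r) term_coef lam r p * rho (S v (mono (term_sites r p))))
  u b) => //.
- by rewrite !mulr_ge0 ?exprn_ge0.
- move=> e /(bfun_expansion r M0 rhoP) [h0 h00 H]; exists h0 => // h v hh0 uv.
  by apply: H => //; exact: le_trans uv.
move=> v /andP[uv vb]; apply: (le_trans (ler_norm_sum _ _ _)).
(* The induction hypothesis is used at [i.+1], since every new monomial has at most [K] more
   sites. *)
set c := M * 'C(i.+1 + n, n)%:R * kappa ^+ n * (b - v) ^+ n.
have c0 : 0 <= c by rewrite !mulr_ge0 ?exprn_ge0// subr_ge0.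
apply: (@le_trans _ _ (\sum_(p <- terms BB r) `|term_coef lam r p| * c)).
  rewrite big_seq [leRHS]big_seq; apply: ler_sum => p pr.
  rewrite normrM ler_wpM2l//.
  apply: IHn; last by rewrite (le_trans u0 uv).
  apply: (leq_trans (size_term_sites pr)); rewrite mulnS addnC.
  by apply: leq_add.
rewrite -mulr_suml.
apply: (@le_trans _ _ (2 * Lam * (size r)%:R * c)).
  by rewrite ler_wpM2r// sum_term_coef.
apply: (@le_trans _ _ (2 * Lam * (K * i.+1)%:R * c)).
  rewrite ler_wpM2r// ler_wpM2l ?ler_nat//.
  by rewrite mulr_ge0// sumr_ge0.
(* The weight [i.+1] of the generator is exchanged for the factor [n.+1] that integration
   removes. *)
have binE : n.+1%:R * 'C(i + n.+1, n.+1)%:R = i.+1%:R * 'C(i.+1 + n, n)%:R :> R.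
  by rewrite -!natrM addnS -addSn mul_bin_left addnK.
rewrite /c natrM exprS le_eqVlt; apply/orP; left; apply/eqP.
transitivity (M * (i.+1%:R * 'C(i.+1 + n, n)%:R) *
  (kappa * kappa ^+ n) * (b - v) ^+ n).
  by rewrite /kappa; ring.
by rewrite -binE; ring.
Qed.

Lemma bin_le_exp2 m n : ('C(m, n) <= 2 ^ m)%N.
Proof.
elim: m n => [|m IHm] [|n] //; first by rewrite bin0 expn_gt0.
by rewrite binS expnS mul2n -addnn leq_add.
Qed.

(** Makes [2 * kappa * delta] at most one half, also when [kappa] is 0; it depends only on the
    rates. *)
Let delta : R := (4 * kappa + 1)^-1 / 2.

Lemma delta_gt0 : 0 < delta.
Proof. by rewrite divr_gt0// invr_gt0 ltr_wpDl// mulr_ge0// kappa_ge0. Qed.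

Lemma kappa_delta : 2 * (kappa * delta) <= 2^-1.
Proof.
have k0 := kappa_ge0.
have kp : 0 < 4 * kappa + 1 by lra.
have -> : 2 * (kappa * delta) = kappa / (4 * kappa + 1).
  by rewrite /delta; field; lra.
rewrite ler_pdivrMr//; lra.
Qed.

(** With [i := size r] and binomials bounded by powers of 2, the Taylor bounds decay geometrically
    in [n]; [size r] enters only the prefactor, so [delta] serves all monomials. *)
Lemma vanish_back M rho b r u : 0 <= M -> bounded_functional M rho ->
  (forall r, rho (S b (mono r)) = 0) -> 0 <= u <= b -> b - u <= delta ->
  rho (S u (mono r)) = 0.
Proof.
move=> M0 rhoP rhob ub bud; have k0 := kappa_ge0.
have bu0 : 0 <= b - u by case/andP: ub; rewrite subr_ge0.
set x := rho _; set c := M * 2 ^+ size r.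
have c0 : 0 <= c by rewrite mulr_ge0.
have H n : `|x| <= c * 2^-1 ^+ n.
  have rK : (size r <= K * (size r).+1)%N.
    by rewrite mulSn; apply: leq_trans (leq_addr _ _).
  apply: le_trans (taylor_bound n M0 rhoP rhob rK ub) _.
  apply: (@le_trans _ _ (M * 2 ^+ (size r + n) * kappa ^+ n * delta ^+ n)).
    apply: ler_pM; rewrite ?mulr_ge0 ?exprn_ge0//; last first.
      by rewrite lerXn2r ?nnegrE// ltW// delta_gt0.
    by rewrite ler_wpM2r ?exprn_ge0// ler_wpM2l// -natrX ler_nat bin_le_exp2.
  rewrite exprD -!mulrA -!exprMn ler_wpM2l// ler_wpM2l ?exprn_ge0// lerXn2r//.
  - by rewrite nnegrE mulr_ge0// mulr_ge0// ltW// delta_gt0.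
  - by rewrite nnegrE.
  - exact: kappa_delta.
apply/normr0_eq0/le_anti; rewrite normr_ge0 andbT.
have cv : c * 2^-1 ^+ n @[n --> \oo] --> c * 0.
  by apply: cvgMr; apply: cvg_expr; rewrite gtr0_norm ?invf_lt1// ltr1n.
rewrite mulr0 in cv; rewrite -(cvg_lim _ cv)//; apply: limr_ge.
  by apply/cvg_ex; exists 0.
by apply: nearW.
Qed.

(** Vanishing of all monomials at time [b] gives the same at [b - delta], so finitely many steps
    reach time 0; the last one is shortened to keep times nonnegative. *)
Lemma vanish_zero M rho b r : 0 <= M -> bounded_functional M rho -> 0 <= b ->
  (forall r, rho (S b (mono r)) = 0) -> rho (mono r) = 0.
Proof.
move=> M0 rhoP b0 rhob.
have [k] : exists k : nat, b <= k%:R * delta.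
  exists (Num.truncn (b / delta)).+1.
  by rewrite -ler_pdivrMr ?delta_gt0//; apply: ltW; exact: truncnS_gt.
elim: k b b0 rhob => [|k IHk] b b0 rhob bk.
  have {}b0 : b = 0 by apply/le_anti; rewrite b0 andbT; rewrite mul0r in bk.
  rewrite -(rhob r) b0 (msg_id S_markov)//; exact: continuous_mono.
have [bd|db] := leP b delta.
  rewrite -[mono r](msg_id S_markov); last exact: continuous_mono.
  by apply: (vanish_back _ M0 rhoP rhob); rewrite ?lexx ?b0// subr0.
apply: (IHk (b - delta)); first by rewrite subr_ge0 ltW.
  move=> q; apply: (vanish_back _ M0 rhoP rhob).
    by rewrite subr_ge0 (ltW db)/= gerBl ltW// delta_gt0.
  by rewrite opprB addrCA subrr addr0.
by rewrite lerBlDr -[X in _ + X]mul1r -mulrDl natr1.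
Qed.

End Semigroup.

(** * Injectivity of the evolution on probability measures *)

Lemma bfun_sub (R : realType) (d : nat) (M N : R)
    (rho tau : (Omega d -> R) -> R) :
  bounded_functional M rho -> bounded_functional N tau ->
  bounded_functional (M + N) (fun f => rho f - tau f).
Proof.
move=> [rl rb] [tl tb]; split=> [a f g cf cg|c f cf fc].
  by rewrite rl// tl//; ring.
by rewrite (le_trans (ler_normB _ _))// mulrDl lerD ?rb ?tb.
Qed.

Theorem corollary4p1 (R : realType) (d : nat)
    (BB : {fset {fset lattice d}}) (lam : {fset lattice d} -> R)
    (S : R -> (Omega d -> R) -> (Omega d -> R))
    (mu nu : probability (borelOmega d) R) :
  positive_rates BB lam ->
  spinflip_semigroup BB lam S ->
  ~ same_measure mu nu ->
  forall (t : R) (mut nut : probability (borelOmega d) R), 0 < t ->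
    evolved S t mu mut -> evolved S t nu nut ->
    ~ same_measure mut nut.
Proof.
move=> _ hS munu t mut nut t0 mutE nutE same; apply: munu.
have t0' := ltW t0; have [S_markov _] := hS.
pose rho (f : Omega d -> R) := \int[mu]_s f s - \int[nu]_s f s.
have rhoP := bfun_sub (bfun_Rintegral mu) (bfun_Rintegral nu).
(* By the definition of the evolved measures, both integrals are those of [mono r] at time [t]. *)
have rhot r : rho (S t (mono r)) = 0.
  apply/eqP; rewrite subr_eq0; apply/eqP; rewrite /Rintegral; congr fine.
  have cm := @continuous_mono R d r.
  rewrite -(mutE _ cm) -(nutE _ cm); apply: eq_measure_integral => A mA _.
  exact: same.
have rho0 r : rho (mono r) = 0.
  by apply: (vanish_zero hS r _ rhoP t0' rhot).
apply: same_measure_up => r.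
have mr : measurable (up r : set (borelOmega d)).
  by apply: sub_sigma_algebra; exact: open_up.
have := bfun_indic_up0 r rhoP rho0.
rewrite /rho /Rintegral !integral_indic// !setIT => /eqP.
rewrite subr_eq0 => /eqP eq_fine.
(* The real-valued integrals compare only the images under [fine]; finiteness of the masses recovers
   the extended values. *)
have mufin (m : probability (borelOmega d) R) : m (up r) \is a fin_num.
  exact: fin_num_measure.
by rewrite -(fineK (mufin mu)) -(fineK (mufin nu)) eq_fine.
Qed.
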